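(* Let $\alpha\in(0,1)$ and $\kappa>0$. There exists a constant $C>0$ depending only on $\kappa$ and $\alpha$ such that the following holds for all integers $n,T\ge 2$ and all $\tau$ with $0<\tau\leq\kappa\sqrt{nT}/12$. Let $\psi$ be a measurable function taking values in $[0,1]$ such that $$\sup_{M\in\mathcal{M}^{\rm null}(\tau)}\mathbb{E}_{M}\psi(X_{-1,-1})\leq\alpha .$$ Then $$\inf_{M\in\mathcal{M}_{\rho}(\tau)}\mathbb{E}_{M}\psi(X_{-1,-1})\leq 2\alpha,\qquad\text{where }\rho=C\min\{1,\sqrt{n+T}/\tau\}.$$
   Context: Model: $X=M+u$ where $M\in\mathbb{R}^{n\times T}$ is non-random and the entries $u_{i,t}$ of $u\in\mathbb{R}^{n\times T}$ are i.i.d. $N(0,1)$. The observed data is $X_{-1,-1}$, i.e. all entries of $X$ except the $(1,1)$ entry (formally, $A_{-1,-1}$ is $A$ with its $(1,1)$ entry replaced by zero). $\mathbb{P}_M,\mathbb{E}_M$ denote probability and expectation when the mean matrix is $M$. For a matrix $A$, $\|A\|_\infty=\max_{i,j}|A_{i,j}|$ and $\sigma_1(A)\ge\sigma_2(A)\ge\cdots$ are its singular values. Define $\mathcal{M}=\{A\in\mathbb{R}^{n\times T}:\|A\|_\infty\le\kappa,\ \mathrm{rank}\,A\le2\}$, $\mathcal{M}(\tau)=\{A\in\mathcal{M}:\sigma_1(A)\ge\tau,\ \sigma_2(A)=0\}$, $\mathcal{M}^{\rm null}(\tau)=\{M\in\mathcal{M}(\tau):M_{1,1}=0\}$, and $\mathcal{M}_\rho(\tau)=\{M\in\mathcal{M}(\tau):|M_{1,1}|\ge\rho\}$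 for $\rho>0$. *)

(* Defs.v *)
From mathcomp Require Import all_boot all_order all_algebra.
From mathcomp Require Import polyrcf.
From mathcomp Require Import all_classical all_reals all_analysis.

Set Implicit Arguments.
Unset Strict Implicit.
Unset Printing Implicit Defensive.

Import Order.TTheory GRing.Theory Num.Theory.
Import numFieldNormedType.Exports.

Local Open Scope classical_set_scope.
Local Open Scope ring_scope.

(* Square roots of the eigenvalues of A^T A, repeated according to their
   algebraic multiplicity, in nonincreasing order.  For A of size n x m the list
   has m entries, so for n < m it ends with (at least) m - n zeros. *)
Definition singular_values (R : realType) (n m : nat) (A : 'M[R]_(n, m)) :
    seq R :=
  let p := char_poly (A^T *m A) in
  sort >=%R (flatten [seq nseq (mup x p) (Num.sqrt x) | x <- rootsR p]).

(* Numbered from k = 1, as in sigma_1(A) >= sigma_2(A) >= ... *)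
Definition sigma (R : realType) (n m : nat) (k : nat) (A : 'M[R]_(n, m)) : R :=
  (singular_values A)`_k.-1.

(* The norm `|A| on 'M[R]_(n, m) is the entrywise maximum max_(i,j) `|A i j|. *)
Definition Mset (R : realType) (kappa : R) (n m : nat) :
    set 'M[R]_(n.+1, m.+1) :=
  [set A | `|A| <= kappa /\ (\rank A <= 2)%N].

Definition Mtau (R : realType) (kappa : R) (n m : nat) (tau : R) :
    set 'M[R]_(n.+1, m.+1) :=
  [set A | Mset kappa A /\ tau <= sigma 1 A /\ sigma 2 A = 0].

Definition Mnull (R : realType) (kappa : R) (n m : nat) (tau : R) :
    set 'M[R]_(n.+1, m.+1) :=
  [set A | Mtau kappa tau A /\ A ord0 ord0 = 0].

Definition Mrho (R : realType) (kappa : R) (n m : nat) (rho tau : R) :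
    set 'M[R]_(n.+1, m.+1) :=
  [set A | Mtau kappa tau A /\ rho <= `|A ord0 ord0|].

(* A_{-1,-1}: the observed part of A, i.e. A with its (1,1) entry set to 0. *)
Definition drop11 (R : realType) (n m : nat) (A : 'M[R]_(n.+1, m.+1)) :
    'M[R]_(n.+1, m.+1) :=
  \matrix_(i, j) if (i == ord0) && (j == ord0) then 0 else A i j.

(* Generator of the Borel sigma-algebra of the finite-dimensional space
   'M[R]_(n, m), taken as the product of the Borel sigma-algebras of the
   entries. *)
Definition mx_cylinders (R : realType) (n m : nat) : set (set 'M[R]_(n, m)) :=
  [set S | exists (i : 'I_n) (j : 'I_m) (B : set R),
     measurable B /\ S = [set A : 'M[R]_(n, m) | B (A i j)]].

Definition mx_measurable_fun (R : realType) (n m : nat)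
    (f : 'M[R]_(n, m) -> R) : Prop :=
  measurable_fun setT (f : g_sigma_algebraType (@mx_cylinders R n m) -> R).

(* Mutual independence.  Since B i may be setT, the product rule for the whole
   finite family contains the product rule for every subfamily. *)
Definition mutually_independent (d : measure_display) (Omega : measurableType d)
    (R : realType) (P : probability Omega R) (I : finType)
    (X : I -> {RV P >-> R}) : Prop :=
  forall B : I -> set R, (forall i, measurable (B i)) ->
    P [set w | forall i, B i (X i w)] = (\prod_i P (X i @^-1` B i))%E.

Definition iid_std_normal (d : measure_display) (Omega : measurableType d)
    (R : realType) (P : probability Omega R) (I : finType)
    (X : I -> {RV P >-> R}) : Prop :=
  mutually_independent X /\
  forall (i : I) (B : set R), measurable B ->
    distribution P (X i) B = normal_prob 0 1 B.

(* E_M psi(X_{-1,-1}) for the model X = M + u. *)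
Definition Epsi (d : measure_display) (Omega : measurableType d) (R : realType)
    (P : probability Omega R) (n m : nat)
    (u : 'I_n.+1 -> 'I_m.+1 -> {RV P >-> R})
    (psi : 'M[R]_(n.+1, m.+1) -> R) (M : 'M[R]_(n.+1, m.+1)) : \bar R :=
  'E_P[fun w => psi (drop11 (M + \matrix_(i, j) u i j w))]%E.

(* Main.v *)
Require Import Defs.
From HB Require Import structures.
From mathcomp Require Import all_boot all_order all_algebra.
From mathcomp Require Import polyrcf.
From mathcomp Require Import all_classical all_reals all_analysis.
From mathcomp Require Import measurable_realfun.
From mathcomp Require Import ring lra.

(** Two points suffice. Since [E_M psi] sees M only through its entries off the
    corner, a level-alpha test cannot separate a null M0 from an alternative M1
    when the Euclidean distance of these entries is small, whatever the
    corner entries are.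

    _Indistinguishability._ Put delta = M1 - M0 off the corner, and 0 at the
    corner. The law of the observed entries under M1 has density
    L = exp(<delta, u> - |delta|^2/2), where u = X - M0, with respect to their
    law under M0, and [E L = 1], [E L^2 = exp(|delta|^2)].
    For y = psi in [0, 1], the square (L - 1 - alpha y)^2 >= 0 gives
      2 alpha y L + 2 L <= 2 alpha y + L^2 + alpha^2 + 1,
    whose expectation is [E_M1 psi <= E_M0 psi + alpha] once
    exp(|delta|^2) <= 1 + alpha^2 ([Epsi_two_point]). The density formula
    ([Epsi_tilt]) only has to be checked on rectangles, because these generate
    the sigma-algebra of the matrix space; there it is the product rule for
    expectations of independent variables ([indep_expectation_prod]) combined
    with the one-dimensional Cameron-Martin formula
    ([integral_tilt_normal_prob]).

    _The two points._ If n >= T, take M0 = a0 b and M1 = a1 b with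
    a0 = (0, 1, ..., 1)^T, a1 = (eps, 1, ..., 1)^T,
    b = (kappa, beta, ..., beta), eps = rho / kappa and
    beta = 2 tau / sqrt(nT). The corner of M1 is eps * kappa = rho. The choice
    of beta makes the singular value |a| |b| at least tau
    ([singular_values_rank1]). Off the corner, M1 - M0 is eps * beta on the
    first row, so its squared norm (T - 1) (eps beta)^2 is at most
    4 (rho tau / kappa)^2 / n, hence at most
    8 (rho tau / kappa)^2 / (n + T) <= 8 C^2 / kappa^2. If T > n, the row and
    the column exchange their roles ([two_points_exist]). It remains to choose
    C <= kappa (so that eps <= 1) with 8 C^2 / kappa^2 <= ln (1 + alpha^2). *)

Set Implicit Arguments.
Unset Strict Implicit.
Unset Printing Implicit Defensive.

Import Order.TTheory GRing.Theory Num.Theory.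
Import numFieldNormedType.Exports.

Local Open Scope classical_set_scope.
Local Open Scope ring_scope.

(** * Measures with a density *)

Section density_measure.
Local Open Scope ereal_scope.
Context d (T : measurableType d) (R : realType).
Variables (mu : {measure set T -> \bar R}) (g : T -> R).
Hypotheses (g0 : forall x, (0 <= g x)%R) (mg : measurable_fun setT g).

(** The two proofs are arguments so that the measure structure below can be
    inferred from the term [with_density g0 mg] alone. *)
Definition with_density of (forall x, (0 <= g x)%R) & measurable_fun setT g :=
  fun A : set T => \int[mu]_(x in A) (g x)%:E.

Let with_density0 : with_density g0 mg set0 = 0.
Proof. by rewrite /with_density integral_set0. Qed.

Let with_density_ge0 A : 0 <= with_density g0 mg A.
Proof. by apply: integral_ge0 => x _; rewrite lee_fin. Qed.

Let with_density_sigma_additive : semi_sigma_additive (with_density g0 mg).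
Proof.
move=> A mA tA mUA; rewrite /with_density ge0_integral_bigcup//.
- apply: is_cvg_ereal_nneg_natsum_cond => n _ _.
  by apply: integral_ge0 => x _; rewrite lee_fin.
- exact/measurable_EFinP/measurable_funTS.
- by move=> x _; rewrite lee_fin.
Qed.

HB.instance Definition _ := isMeasure.Build _ _ _ (with_density g0 mg)
  with_density0 with_density_ge0 with_density_sigma_additive.

Import HBNNSimple.

(** By monotone convergence from simple functions, for which the identity is
    the definition of [with_density]. *)
Lemma ge0_integral_density (f : T -> \bar R) :
  measurable_fun setT f -> (forall x, 0 <= f x) ->
  \int[with_density g0 mg]_x f x = \int[mu]_x (f x * (g x)%:E).
Proof.
move=> mf f0; pose f_ := nnsfun_approx measurableT mf.
have f_cvg x : EFin \o f_ ^~ x @ \oo --> f x by exact: cvg_nnsfun_approx.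
have f_nd x : {homo f_ ^~ x : m n / (m <= n)%N >-> (m <= n)%R}.
  by move=> m n mn; exact/lefP/nd_nnsfun_approx.
have mfg n : measurable_fun setT (fun x => (f_ n x * g x)%:E).
  by apply/measurable_EFinP/measurable_funM.
transitivity (limn (fun n => \int[with_density g0 mg]_x (f_ n x)%:E)).
  rewrite -monotone_convergence//.
  - by apply: eq_integral => x _; apply/esym/cvg_lim => //; exact: f_cvg.
  - by move=> n; exact/measurable_EFinP/measurable_funTS.
  - by move=> n x _; rewrite lee_fin.
  - by move=> x _ m n mn; rewrite lee_fin; exact: f_nd.
transitivity (limn (fun n => \int[mu]_x (f_ n x * g x)%:E)); last first.
  rewrite -monotone_convergence//.
  - apply: eq_integral => x _; apply/cvg_lim => //.
    under eq_fun do rewrite EFinM.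
    by apply: cvgeMr => //; exact: f_cvg.
  - by move=> n x _; rewrite lee_fin mulr_ge0.
  - by move=> x _ m n mn; rewrite lee_fin ler_wpM2r//; exact: f_nd.
congr (limn _); apply/funext => n.
under [LHS]eq_integral do rewrite fimfunE -fsumEFin//.
rewrite [LHS]ge0_integral_fsum//; last 2 first.
  - by move=> r; exact/measurable_EFinP/measurableT_comp.
  - by move=> r x _; rewrite EFinM nnfun_muleindic_ge0.
under [RHS]eq_integral.
  move=> x _; rewrite EFinM fimfunE -fsumEFin// ge0_mule_fsuml; last first.
    by move=> r; rewrite EFinM nnfun_muleindic_ge0.
  over.
rewrite [RHS]ge0_integral_fsum//; last 2 first.
  - move=> r; under eq_fun do rewrite -EFinM.
    by apply/measurable_EFinP; apply: measurable_funM => //; apply: measurable_funM.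
  - move=> r x _; apply: mule_ge0; last by rewrite lee_fin.
    by rewrite EFinM nnfun_muleindic_ge0.
apply: eq_fsbigr => r _.
rewrite integralZl_indic_nnsfun// integral_indic//= setIT /with_density.
rewrite (integral_mkcond (f_ n @^-1` [set r])).
have [r0|r0] := leP 0%R r; last first.
  rewrite preimage_nnfun0// patch_set0 integral0 mule0.
  rewrite integral0_eq// => x _; rewrite indicE in_set0 mulr0 mul0e//.
have mr : measurable (f_ n @^-1` [set r]) by [].
rewrite -ge0_integralZl//.
- apply: eq_integral => x _; rewrite patchE indicE.
  by case: ifPn => _; rewrite ?mulr1 ?mulr0 ?mule0 ?mul0e.
- apply: ((measurable_restrictT _ mr).1).
  exact/measurable_EFinP/measurable_funTS.
- by move=> x _; rewrite patchE; case: ifPn => _ //; rewrite lee_fin.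
Qed.
End density_measure.

(** * Products of independent random variables *)

Section indep_product.
Local Open Scope ereal_scope.
Context d (Omega : measurableType d) (R : realType) (P : probability Omega R).
Context (I : finType) (X : I -> {RV P >-> R}).
Hypothesis indX : mutually_independent X.

(** Independence is the case of indicator functions. The general case replaces
    one indicator at a time by an arbitrary [f i]: if G is the product of the
    other factors and c its expectation, the product rule for indicators at
    place i says that the image under X i of the measure with density G is c
    times the law of X i, and it remains to integrate [f i] against these equal
    measures. *)
Lemma indep_expectation_prod (f : I -> R -> R) :
    (forall i x, (0 <= f i x)%R) -> (forall i, measurable_fun setT (f i)) ->
    (forall i, \int[P]_w (f i (X i w))%:E < +oo) ->
  \int[P]_w (\prod_i f i (X i w))%:E = \prod_i \int[P]_w (f i (X i w))%:E.
Proof.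
(* Outside s, the factors are indicators; the induction shortens s. *)
have [s hs] : exists s : seq I, forall i, i \notin s ->
    exists B, measurable B /\ f i = \1_B.
  by exists (enum I) => i; rewrite mem_enum.
elim: s f hs => [|i s IH] f hs f0 mf foo.
  have /choice[B hB] : forall i, exists B, measurable B /\ f i = \1_B.
    by move=> i; exact: hs.
  have mB i : measurable (B i) by have [] := hB i.
  have mXB i : measurable (X i @^-1` B i).
    by rewrite -[X in measurable X]setTI; exact: measurable_funP.
  pose E := [set w | forall i, B i (X i w)].
  have mE : measurable E.
    rewrite (_ : E = \bigcap_(i in [set: I]) (X i @^-1` B i)); last first.
      by apply/seteqP; split=> w Ew i; [move=> _; exact: Ew|exact: Ew].
    exact: fin_bigcap_measurable.
  transitivity (P E).
    transitivity (\int[P]_w (\1_E w)%:E); last by rewrite integral_indic// setIT.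
    apply: eq_integral => w _; congr _%:E.
    under eq_bigr do rewrite (hB _).2 indicE.
    rewrite indicE; case: (boolP (w \in E)) => [/[!inE] wE|].
      by rewrite big1// => i _; rewrite mem_set//; exact: wE.
    rewrite notin_setE /E/= => /existsNP[i nB].
    by rewrite (bigD1 i)//= memNset ?mul0r.
  rewrite indX//; apply: eq_bigr => i _.
  rewrite -[X in P X = _]setIT -integral_indic//.
  by apply: eq_integral => w _; rewrite (hB i).2 !indicE.
pose G w := (\prod_(j | j != i) f j (X j w))%R.
have G0 w : (0 <= G w)%R by apply: prodr_ge0 => j _.
have mfX j : measurable_fun setT (fun w => f j (X j w)).
  exact: measurableT_comp.
have mG : measurable_fun setT G.
  rewrite (_ : G = fun w => (\prod_j if j != i then f j (X j w) else 1)%R).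
    by apply: measurable_prod => j _; case: (j != i).
  by apply/funext => w; rewrite /G big_mkcond.
pose c := \prod_(j | j != i) \int[P]_w (f j (X j w))%:E.
have c_ge0 : 0 <= c.
  by apply: prode_ge0 => j _; apply: integral_ge0 => w _; rewrite lee_fin.
have c_fin : c \is a fin_num.
  rewrite /c; elim/big_ind : _ => // [x y xf yf|j _]; first exact: fin_numM.
  rewrite ge0_fin_numE//; by apply: integral_ge0 => w _; rewrite lee_fin.
have key A : measurable A ->
   pushforward (with_density P G0 mG) (X i) A
   = with_density (distribution P (X i)) (fun=> fine_ge0 c_ge0)
       (measurable_cst _) A.
  move=> mA; have mXA : measurable (X i @^-1` A).
    by rewrite -[X in measurable X]setTI; exact: measurable_funP.
  pose f' j := if j == i then \1_A else f j.
  have f'0 j x : (0 <= f' j x)%R by rewrite /f'; case: ifP.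
  have mf' j : measurable_fun setT (f' j) by rewrite /f'; case: (j == i).
  have intA : \int[P]_w (\1_A (X i w))%:E = P (X i @^-1` A).
    rewrite -[X in P X]setIT -integral_indic//.
  have hs' j : j \notin s -> exists B, measurable B /\ f' j = \1_B.
    rewrite /f'; case: eqVneq => [_ _|ji js]; first by exists A.
    by apply: hs; rewrite inE negb_or ji.
  have f'oo j : \int[P]_w (f' j (X j w))%:E < +oo.
    rewrite /f'; case: eqVneq => [->|//].
    by rewrite intA (le_lt_trans (probability_le1 _ _))// ltry.
  have f'i : f' i = \1_A by rewrite /f' eqxx.
  have := IH f' hs' f'0 mf' f'oo.
  rewrite [in RHS](bigD1 i)//= f'i intA => IH'.
  rewrite /with_density/= integral_cst// fineK// muleC.
  rewrite /pushforward/= -/(distribution P (X i) A) integral_mkcond.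
  transitivity (\int[P]_w (\prod_j f' j (X j w))%:E).
    apply: eq_integral => w _; rewrite (bigD1 i)//= f'i patchE indicE.
    rewrite (eq_bigr (fun j => f j (X j w))); last first.
      by move=> j ji; rewrite /f' (negbTE ji).
    rewrite -[w \in _ @^-1` _]/(X i w \in A).
    by case: ifP => _; rewrite ?mul1r ?mul0r.
  rewrite IH'; congr *%E; apply: eq_bigr => j ji.
  by apply: eq_integral => w _; rewrite /f' (negbTE ji).
rewrite (bigD1 i)//= -/c.
transitivity (\int[pushforward (with_density P G0 mG) (X i)]_x (f i x)%:E).
  rewrite ge0_integral_pushforward//; last first.
  - by move=> x _; rewrite lee_fin.
  - exact/measurable_EFinP.
  rewrite preimage_setT ge0_integral_density//.
  - by apply: eq_integral => w _; rewrite (bigD1 i).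
  - exact/measurable_EFinP.
  - by move=> x /=; rewrite lee_fin.
rewrite (eq_measure_integral (with_density (distribution P (X i))
  (fun=> fine_ge0 c_ge0) (measurable_cst _))); last first.
  by move=> A mA _; exact: key.
rewrite ge0_integral_density//;
  [|exact/measurable_EFinP|by move=> x; rewrite lee_fin].
rewrite ge0_integralZr//;
  [|exact/measurable_EFinP|by move=> x _; rewrite lee_fin
   |by rewrite lee_fin fine_ge0].
rewrite ge0_integral_distribution//;
  [|exact/measurable_EFinP|by move=> x; rewrite lee_fin].
by rewrite fineK.
Qed.
End indep_product.

(** * Exponential tilting of Gaussian vectors *)

Section gaussian_tilt.
Context (R : realType).
Implicit Types (c x : R).

(** The density of N(c, 1) with respect to N(0, 1). *)
Definition tilt c x := expR (c * x - c ^+ 2 / 2).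

Lemma tilt_ge0 c x : 0 <= tilt c x.
Proof. exact: expR_ge0. Qed.

Lemma measurable_tilt c : measurable_fun setT (tilt c).
Proof.
apply: measurableT_comp => //; apply: measurable_funB => //.
Qed.

(** Squares of tilts are again tilts up to a constant, so second moments reduce
    to total masses. *)
Lemma tilt_sqr c x : tilt c x ^+ 2 = expR (c ^+ 2) * tilt (2 * c) x.
Proof. by rewrite /tilt -expRM_natl -expRD; congr expR; field. Qed.

Lemma normal_pdf_tilt c x :
  tilt c x * normal_pdf 0 1 x = normal_pdf 0 1 (x - c).
Proof.
rewrite !normal_pdfE ?oner_eq0// /normal_fun mulrCA -expRD.
by congr (_ * expR _); rewrite subr0 expr1n; field.
Qed.

Lemma lebesgue_measure_translation c (A : set R) : measurable A ->
  (lebesgue_measure ((fun x : R => x + c)%R @^-1` A) = lebesgue_measure A)%E.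
Proof.
move=> mA.
have mf : measurable_fun [set: measurableTypeR R]
    ((fun x => x + c) : _ -> measurableTypeR R) by exact: measurable_funD.
apply/esym; apply: (@lebesgue_measure_unique R (pushforward lebesgue_measure
   ((fun x => x + c) : _ -> measurableTypeR R))) => //= _ [[a b]] _ <-.
rewrite /pushforward/= (_ : _ @^-1` _ = `]a - c, b - c]%classic); last first.
  by apply/seteqP; split=> x/=; rewrite !in_itv/= ltrBlDr lerBrDr.
rewrite !lebesgue_measure_itv/= !lte_fin ltrD2r.
by case: ifP => // _; rewrite -!EFinB; congr _%:E; ring.
Qed.

(** The one-dimensional Cameron-Martin formula: both sides are the mass of A
    under N(c, 1), by [normal_pdf_tilt] and by translation invariance. *)
Lemma integral_tilt_normal_prob c (A : set R) : measurable A ->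
  (\int[normal_prob 0 1]_(x in A) (tilt c x)%:E =
   normal_prob 0 1 [set x | A (x + c)%R])%E.
Proof.
move=> mA.
have mf : measurable_fun [set: measurableTypeR R]
    ((fun x => x + c) : _ -> measurableTypeR R) by exact: measurable_funD.
have pdf0 x : 0 <= normal_pdf 0 1 x :> R by exact: normal_pdf_ge0.
have mtA : measurable_fun setT ((fun x => (tilt c x)%:E) \_ A).
  apply: ((measurable_restrictT _ mA).1).
  by apply/measurable_EFinP/measurable_funTS; exact: measurable_tilt.
have tA0 x : (0 <= ((fun x => (tilt c x)%:E) \_ A) x)%E.
  by rewrite patchE; case: ifP => // _; rewrite lee_fin tilt_ge0.
rewrite integral_mkcond.
rewrite (eq_measure_integral (with_density lebesgue_measure pdf0
  (measurable_normal_pdf 0 1)))//.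
rewrite ge0_integral_density//.
transitivity (\int[pushforward lebesgue_measure
   ((fun x => x + c)%R : _ -> measurableTypeR R)]_(x in A)
     (normal_pdf 0 1 (x - c)%R)%:E)%E.
  rewrite [RHS]integral_mkcond.
  rewrite [RHS](eq_measure_integral lebesgue_measure); last first.
    move=> B mB _; exact: lebesgue_measure_translation.
  apply: eq_integral => x _; rewrite !patchE; case: ifP => _; last by rewrite mul0e.
  by rewrite -EFinM normal_pdf_tilt.
rewrite ge0_integral_pushforward//; last first.
- by move=> x _; rewrite lee_fin.
- apply/measurable_EFinP/measurable_funTS.
  apply: (measurableT_comp (measurable_normal_pdf 0 1)).
  exact: measurable_funB.
by apply: eq_integral => x _ /=; rewrite addrK.
Qed.
End gaussian_tilt.

Section gaussian_vector.
Local Open Scope ereal_scope.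
Context d (Omega : measurableType d) (R : realType) (P : probability Omega R).
Context (I : finType) (X : I -> {RV P >-> R}) (c : I -> R).
Hypothesis iidX : iid_std_normal X.

Definition joint_tilt w : R := (\prod_i tilt (c i) (X i w))%R.

Lemma joint_tilt_ge0 w : (0 <= joint_tilt w)%R.
Proof. by apply: prodr_ge0 => i _; exact: tilt_ge0. Qed.

Lemma measurable_joint_tilt : measurable_fun setT joint_tilt.
Proof.
apply: measurable_prod => i _.
exact: (measurableT_comp (measurable_tilt (c i))).
Qed.

(** The two sides live on different structures of measurable space on R (with
    the same measurable sets), hence the detour through [measurableTypeR]. *)
Lemma integral_iid (i : I) (f : R -> \bar R) :
    measurable_fun setT f -> (forall x, 0 <= f x) ->
  \int[P]_w f (X i w) = \int[normal_prob 0 1]_x f x.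
Proof.
move=> mf f0.
have mX : measurable_fun setT (X i : Omega -> measurableTypeR R).
  by move=> _ B mB; exact: (measurable_funP (X i) measurableT B mB).
transitivity (\int[pushforward P (X i : Omega -> measurableTypeR R)]_x f x).
  by rewrite ge0_integral_pushforward.
rewrite (eq_measure_integral (normal_prob 0 1))//.
by move=> A mA _; exact: iidX.2.
Qed.

(** Both sides factor over the coordinates, where they agree by
    [integral_tilt_normal_prob]. *)
Lemma joint_tilt_rectangle (B : I -> set R) : (forall i, measurable (B i)) ->
  \int[P]_(w in [set w | forall i, B i (X i w)]) (joint_tilt w)%:E =
  P [set w | forall i, B i (X i w + c i)%R].
Proof.
move=> mB.
pose f i x := (tilt (c i) x * \1_(B i) x)%R.
have f0 i x : (0 <= f i x)%R by rewrite mulr_ge0// tilt_ge0.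
have mf i : measurable_fun setT (f i).
  by apply: measurable_funM => //; exact: measurable_tilt.
have mBc i : measurable [set x | B i (x + c i)%R].
  rewrite -[X in measurable X]setTI.
  have mD : measurable_fun setT (fun x : R => x + c i)%R.
    exact: measurable_funD.
  exact: (mD measurableT _ (mB i)).
have fE i : \int[P]_w (f i (X i w))%:E = P [set w | B i (X i w + c i)%R].
  rewrite (integral_iid _ (f := fun x => (f i x)%:E));
    [|exact/measurable_EFinP|by move=> x; rewrite lee_fin].
  rewrite -[RHS]/(distribution P (X i) [set x | B i (x + c i)%R]) iidX.2//.
  rewrite -integral_tilt_normal_prob// [RHS]integral_mkcond.
  apply: eq_integral => x _; rewrite patchE /f indicE.
  by case: ifP => _; rewrite ?mulr1 ?mulr0.
rewrite integral_mkcond.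
transitivity (\int[P]_w (\prod_i f i (X i w))%:E).
  apply: eq_integral => w _; rewrite patchE /f big_split/=.
  case: ifPn => [/[!inE] wB|].
    rewrite [X in (_ * X)%R]big1 ?mulr1// => i _.
    by rewrite indicE mem_set//; exact: wB.
  rewrite notin_setE /= => /existsNP[i nB].
  by rewrite [X in (_ * X)%R](bigD1 i)//= indicE memNset// mul0r mulr0.
have mXBc i : measurable [set w | B i (X i w + c i)%R].
  rewrite -[X in measurable X]setTI.
  exact: (measurable_funP (X i) measurableT _ (mBc i)).
rewrite (indep_expectation_prod iidX.1)//; last first.
  move=> i; rewrite fE.
  by apply: (le_lt_trans (probability_le1 _ (mXBc i))); rewrite ltry.
under eq_bigr do rewrite fE.
by rewrite -(iidX.1 _ mBc).
Qed.

End gaussian_vector.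

Section moments.
Local Open Scope ereal_scope.
Context d (Omega : measurableType d) (R : realType) (P : probability Omega R).
Context (I : finType) (X : I -> {RV P >-> R}) (c : I -> R).
Hypothesis iidX : iid_std_normal X.

Lemma integral_joint_tilt (e : I -> R) : \int[P]_w (joint_tilt X e w)%:E = 1.
Proof.
have := joint_tilt_rectangle e iidX (B := fun=> setT) (fun=> measurableT).
have -> : [set w | forall i, [set: R] (X i w)] = setT by apply/seteqP; split.
by rewrite probability_setT.
Qed.

Lemma integral_joint_tilt_sqr :
  \int[P]_w (joint_tilt X c w ^+ 2)%:E = (expR (\sum_i c i ^+ 2))%:E.
Proof.
have sqrE w : (joint_tilt X c w ^+ 2 =
    expR (\sum_i c i ^+ 2) * joint_tilt X (fun i => 2 * c i) w)%R.
  rewrite /joint_tilt -prodrXl; under eq_bigr do rewrite tilt_sqr.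
  by rewrite big_split/= -expR_sum.
under eq_integral do rewrite sqrE EFinM.
rewrite ge0_integralZl//; first by rewrite integral_joint_tilt mule1.
- by apply/measurable_EFinP; exact: measurable_joint_tilt.
- by move=> w _; rewrite lee_fin; exact: joint_tilt_ge0.
Qed.
End moments.

(** * Laws of random matrices *)

Section mx_law.
Context (R : realType) (n m : nat).
Local Notation mxT := (g_sigma_algebraType (@mx_cylinders R n m)).

Lemma measurable_mx_entry i j :
  measurable_fun setT ((fun A => A i j) : mxT -> R).
Proof.
move=> _ B mB; rewrite setTI; apply: sub_sigma_algebra.
by exists i, j, B.
Qed.

Lemma measurable_mx d (T : measurableType d) (phi : T -> mxT) :
  (forall i j, measurable_fun setT (fun t => phi t i j)) ->
  measurable_fun setT phi.
Proof.
move=> mphi; apply: (@measurability _ _ T mxT setT phi (@mx_cylinders R n m)) => //.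
move=> _ [_ [i [j [B [mB ->]]]] <-].
exact: (mphi i j measurableT B mB).
Qed.

Definition rectangle (B : 'I_n * 'I_m -> set R) : set mxT :=
  [set A | forall ij, B ij (A ij.1 ij.2)].

Lemma measurable_rectangle B : (forall ij, measurable (B ij)) ->
  measurable (rectangle B).
Proof.
move=> mB.
rewrite (_ : rectangle B =
  \bigcap_(ij in [set: 'I_n * 'I_m]) [set A | B ij (A ij.1 ij.2)]); last first.
  by apply/seteqP; split=> A AB ij; [move=> _; exact: AB|exact: AB].
apply: fin_bigcap_measurable => // ij _.
have := measurable_mx_entry ij.1 ij.2 measurableT (mB ij).
by rewrite setTI.
Qed.

(** Rectangles are stable under intersection and generate the sigma-algebra of
    the matrix space. *)
Lemma eq_mx_measure (m1 m2 : {measure set mxT -> \bar R}) :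
  (m1 setT < +oo)%E ->
  (forall B, (forall ij, measurable (B ij)) ->
     m1 (rectangle B) = m2 (rectangle B)) ->
  forall A, measurable A -> m1 A = m2 A.
Proof.
move=> m1oo m12.
pose G := [set S | exists B, (forall ij, measurable (B ij)) /\ S = rectangle B].
apply: (measure_unique G (fun=> setT)).
- apply/seteqP; split.
    apply: smallest_sub; first exact: smallest_sigma_algebra.
    move=> _ [i [j [B [mB ->]]]]; apply: sub_sigma_algebra.
    exists (fun ij => if ij == (i, j) then B else setT); split.
      by move=> ij; case: ifP.
    apply/seteqP; split=> A /=; last by move/(_ (i, j)); rewrite eqxx.
    by move=> AB ij; case: ifP => // /eqP->.
  apply: smallest_sub; first exact: smallest_sigma_algebra.
  by move=> _ [B [mB ->]]; exact: measurable_rectangle.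
- move=> _ _ [B [mB ->]] [C [mC ->]]; exists (fun ij => B ij `&` C ij); split.
    by move=> ij; exact: measurableI.
  apply/seteqP; split=> A /=; first by case=> hB hC ij; split; [exact: hB|exact: hC].
  by move=> ABC; split=> ij; case: (ABC ij).
- move=> _; exists (fun=> setT); split=> //.
  by apply/seteqP; split.
- by rewrite bigcup_const//; exists 0%N.
- by move=> _ [B [mB ->]]; exact: m12.
- by [].
Qed.

Lemma eq_mx_law d1 d2 (T1 : measurableType d1) (T2 : measurableType d2)
   (m1 : {measure set T1 -> \bar R}) (m2 : {measure set T2 -> \bar R})
   (phi1 : T1 -> mxT) (phi2 : T2 -> mxT) (f : mxT -> \bar R) :
  measurable_fun setT phi1 -> measurable_fun setT phi2 ->
  measurable_fun setT f -> (forall A, 0 <= f A)%E ->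
  (m1 setT < +oo)%E ->
  (forall B, (forall ij, measurable (B ij)) ->
     m1 (phi1 @^-1` rectangle B) = m2 (phi2 @^-1` rectangle B)) ->
  (\int[m1]_w f (phi1 w) = \int[m2]_w f (phi2 w))%E.
Proof.
move=> mphi1 mphi2 mf f0 m1oo m12.
transitivity (\int[pushforward m1 phi1]_A f A)%E.
  by rewrite (ge0_integral_pushforward mphi1 m1 measurableT mf) ?preimage_setT.
transitivity (\int[pushforward m2 phi2]_A f A)%E; last first.
  by rewrite (ge0_integral_pushforward mphi2 m2 measurableT mf) ?preimage_setT.
apply: eq_measure_integral => A mA _.
by apply: eq_mx_measure mA.
Qed.
End mx_law.

(** * The two-point bound *)

Section two_point.
Local Open Scope ereal_scope.
Context d (Omega : measurableType d) (R : realType) (P : probability Omega R).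
Context (n m : nat) (u : 'I_n.+1 -> 'I_m.+1 -> {RV P >-> R}).
Hypothesis iidu : iid_std_normal (fun it : 'I_n.+1 * 'I_m.+1 => u it.1 it.2).
Variable psi : 'M[R]_(n.+1, m.+1) -> R.
Hypotheses (mpsi : mx_measurable_fun psi) (psi01 : forall A, (0 <= psi A <= 1)%R).
Local Notation mxT := (g_sigma_algebraType (@mx_cylinders R n.+1 m.+1)).
Local Notation X := (fun it : 'I_n.+1 * 'I_m.+1 => u it.1 it.2).
Local Notation umx w := (\matrix_(i, j) u i j w).

(** The likelihood ratio of two means: the laws of u + drop11 (M1 - M0) under P
    and of u under the tilted measure agree on rectangles, hence everywhere. *)
Lemma Epsi_tilt (M0 M1 : 'M[R]_(n.+1, m.+1)) :
  Epsi u psi M1 = \int[P]_w (psi (drop11 (M0 + umx w)) *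
    joint_tilt X (fun ij => drop11 (M1 - M0) ij.1 ij.2) w)%:E.
Proof.
pose c (ij : 'I_n.+1 * 'I_m.+1) := drop11 (M1 - M0) ij.1 ij.2.
pose L0 := joint_tilt_ge0 X c; pose mL := measurable_joint_tilt X c.
pose f (A : mxT) := (psi (drop11 (M0 + A)))%:E.
have mf : measurable_fun setT f.
  apply/measurable_EFinP; apply: (measurableT_comp mpsi).
  apply: measurable_mx => i j; under eq_fun do rewrite !mxE.
  case: (_ && _); first exact: measurable_cst.
  apply: measurable_funD; first exact: measurable_cst.
  exact: measurable_mx_entry.
rewrite /Epsi unlock.
transitivity (\int[P]_w f (umx w + drop11 (M1 - M0))%R).
  apply: eq_integral => w _; congr (psi _)%:E.
  by apply/matrixP => i j; rewrite !mxE; case: ifP => // _; ring.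
transitivity (\int[with_density P L0 mL]_w f (umx w)); last first.
  rewrite (@ge0_integral_density _ _ _ P _ L0 mL (fun w => f (umx w))).
  - by [].
  - apply: (measurableT_comp mf); apply: measurable_mx => i j.
    under eq_fun do rewrite mxE; exact: measurable_funP.
  - by move=> w; rewrite lee_fin; case/andP: (psi01 (drop11 (M0 + umx w))).
apply: eq_mx_law => //.
- apply: measurable_mx => i j; under eq_fun do rewrite !mxE.
  exact: measurable_funD.
- apply: measurable_mx => i j; under eq_fun do rewrite mxE.
  exact: measurable_funP.
- by move=> A; rewrite lee_fin; case/andP: (psi01 (drop11 (M0 + A))).
- by apply: (le_lt_trans (probability_le1 P measurableT)); rewrite ltry.
move=> B mB; rewrite /= /with_density.
have -> : (fun w => umx w) @^-1` rectangle B = [set w | forall ij, B ij (X ij w)].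
  by apply/seteqP; split=> w /= wB ij; have := wB ij; rewrite mxE.
rewrite joint_tilt_rectangle//; congr (P _).
by apply/seteqP; split=> w /= wB ij; have := wB ij; rewrite 2!mxE.
Qed.

Lemma measurable_psi_model M :
  measurable_fun setT (fun w => psi (drop11 (M + umx w))).
Proof.
apply: (measurableT_comp mpsi).
apply: measurable_mx => i j; under eq_fun do rewrite !mxE.
case: (_ && _); first exact: measurable_cst.
exact: measurable_funD.
Qed.

Lemma Epsi_fin M : exists r : R, Epsi u psi M = r%:E.
Proof.
have E0 : 0 <= Epsi u psi M.
  rewrite /Epsi unlock; apply: integral_ge0 => w _; rewrite lee_fin.
  by case/andP: (psi01 (drop11 (M + umx w))).
exists (fine (Epsi u psi M)); rewrite fineK// ge0_fin_numE//.
apply: (@le_lt_trans _ _ (\int[P]_w 1%:E)).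
  rewrite /Epsi unlock; apply: ge0_le_integral => //.
  - by move=> w _; rewrite lee_fin; case/andP: (psi01 (drop11 (M + umx w))).
  - by apply/measurable_EFinP; exact: measurable_psi_model.
  - by move=> w _; rewrite lee_fin; case/andP: (psi01 (drop11 (M + umx w))).
by have := expectation_cst P 1; rewrite unlock => ->; rewrite ltry.
Qed.

(** A chi-square bound. The radius is chosen so that the likelihood ratio has
    variance at most alpha^2. *)
Lemma Epsi_two_point (alpha : R) (M0 M1 : 'M[R]_(n.+1, m.+1)) : (0 < alpha)%R ->
  (\sum_ij drop11 (M1 - M0) ij.1 ij.2 ^+ 2 <= ln (1 + alpha ^+ 2))%R ->
  Epsi u psi M1 <= Epsi u psi M0 + alpha%:E.
Proof.
move=> alpha0 dist.
pose c (ij : 'I_n.+1 * 'I_m.+1) := drop11 (M1 - M0) ij.1 ij.2.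
pose L := joint_tilt X c.
pose y w := psi (drop11 (M0 + umx w)).
have L0 w : (0 <= L w)%R by exact: joint_tilt_ge0.
have mL : measurable_fun setT L by exact: measurable_joint_tilt.
have y0 w : (0 <= y w)%R by case/andP: (psi01 (drop11 (M0 + umx w))).
have y1 w : (y w <= 1)%R by case/andP: (psi01 (drop11 (M0 + umx w))).
have my : measurable_fun setT y by exact: measurable_psi_model.
have alpha2 : (0 <= 2 * alpha)%R by rewrite mulr_ge0// ltW.
have alphay w : (0 <= 2 * alpha * y w)%R by rewrite mulr_ge0.
have yL w : (0 <= y w * L w)%R by rewrite mulr_ge0.
have myL : measurable_fun setT (fun w => y w * L w)%R by exact: measurable_funM.
have mL2 : measurable_fun setT (fun w => L w ^+ 2)%R by exact: measurable_funX.
have E1 : Epsi u psi M1 = \int[P]_w (y w * L w)%:E by exact: Epsi_tilt.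
have E0 : Epsi u psi M0 = \int[P]_w (y w)%:E by rewrite /Epsi unlock.
have EL : \int[P]_w (L w)%:E = 1 by exact: integral_joint_tilt.
have EL2 : \int[P]_w (L w ^+ 2)%:E <= (1 + alpha ^+ 2)%:E.
  rewrite integral_joint_tilt_sqr// lee_fin -[leRHS]lnK ?ler_expR//.
  by rewrite posrE; nra.
(* Expand (L - 1 - alpha y)^2 >= 0 and use y^2 <= 1. *)
have ptw w : (2 * alpha * (y w * L w) + 2 * L w
    <= 2 * alpha * y w + (L w ^+ 2 + (alpha ^+ 2 + 1)))%R.
  have : (0 <= (L w - 1 - alpha * y w) ^+ 2)%R by exact: sqr_ge0.
  have := y0 w; have := y1 w; move=> ? ? ?.
  have : (alpha ^+ 2 * y w ^+ 2 <= alpha ^+ 2)%R.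
    by rewrite ler_piMr ?sqr_ge0// expr_le1.
  nra.
have intD (f g : Omega -> R) : (forall w, 0 <= f w)%R -> (forall w, 0 <= g w)%R ->
    measurable_fun setT f -> measurable_fun setT g ->
    \int[P]_w (f w + g w)%:E = \int[P]_w (f w)%:E + \int[P]_w (g w)%:E.
  move=> f0 g0 /measurable_EFinP mf /measurable_EFinP mg; under eq_integral do rewrite EFinD.
  by rewrite ge0_integralD// => w _; rewrite lee_fin.
have intZ k (f : Omega -> R) : (0 <= k)%R -> (forall w, 0 <= f w)%R ->
    measurable_fun setT f -> \int[P]_w (k * f w)%:E = k%:E * \int[P]_w (f w)%:E.
  move=> k0 f0 /measurable_EFinP mf; under eq_integral do rewrite EFinM.
  by rewrite ge0_integralZl// => w _; rewrite lee_fin.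
have int_cst : \int[P]_w (alpha ^+ 2 + 1)%:E = (alpha ^+ 2 + 1)%:E.
  by have := expectation_cst P (alpha ^+ 2 + 1); rewrite unlock.
have L20 w : (0 <= L w ^+ 2)%R by exact: sqr_ge0.
have lhs0 w : (0 <= 2 * L w)%R by rewrite mulr_ge0.
have lhs1 w : (0 <= 2 * alpha * (y w * L w))%R by rewrite mulr_ge0.
have rhs0 w : (0 <= L w ^+ 2 + (alpha ^+ 2 + 1))%R by rewrite !addr_ge0 ?sqr_ge0.
have mlhs0 : measurable_fun setT (fun w => 2 * L w)%R by exact: measurable_funM.
have mlhs1 : measurable_fun setT (fun w => 2 * alpha * (y w * L w))%R.
  exact: measurable_funM.
have mrhs0 : measurable_fun setT (fun w => L w ^+ 2 + (alpha ^+ 2 + 1))%R.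
  exact: measurable_funD.
have mrhs1 : measurable_fun setT (fun w => 2 * alpha * y w)%R.
  exact: measurable_funM.
have int1 : \int[P]_w (2 * alpha * (y w * L w) + 2 * L w)%:E
    = (2 * alpha)%:E * Epsi u psi M1 + 2%:E.
  by rewrite intD// !intZ// EL mule1 E1.
have int2 : \int[P]_w (2 * alpha * y w + (L w ^+ 2 + (alpha ^+ 2 + 1)))%:E
    = (2 * alpha)%:E * Epsi u psi M0 + (\int[P]_w (L w ^+ 2)%:E + (alpha ^+ 2 + 1)%:E).
  rewrite intD// intZ// E0 intD ?int_cst//.
  by move=> w; rewrite addr_ge0 ?sqr_ge0.
have : (2 * alpha)%:E * Epsi u psi M1 + 2%:E <= (2 * alpha)%:E * Epsi u psi M0
   + ((1 + alpha ^+ 2)%:E + (alpha ^+ 2 + 1)%:E).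
  rewrite -int1; apply: le_trans (_ : _ <= _) _; last first.
    apply: leeD2l; apply: leeD2r; exact: EL2.
  rewrite -int2; apply: ge0_le_integral => //.
  - by move=> w _; rewrite lee_fin addr_ge0.
  - by apply/measurable_EFinP; exact: measurable_funD.
  - by apply/measurable_EFinP; exact: measurable_funD.
  - by move=> w _; rewrite lee_fin.
have [e0 ->] : exists r, Epsi u psi M0 = r%:E by exact: Epsi_fin.
have [e1 ->] : exists r, Epsi u psi M1 = r%:E by exact: Epsi_fin.
rewrite -!EFinM -!EFinD !lee_fin => H.
rewrite -(ler_pM2l (x := 2 * alpha)%R); last by rewrite mulr_gt0.
nra.
Qed.
End two_point.

(** * Singular values of rank-one matrices *)

(** Two ways of computing the determinant of the block matrix
    (1 v; u x) times (x 0; -u 1). *)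
Lemma det_scalar_sub_rank1 (R : idomainType) (k : nat) (x : R)
    (u : 'cV[R]_k) (v : 'rV[R]_k) :
  x * \det (x%:M - u *m v) = (x - (v *m u) 0 0) * x ^+ k.
Proof.
pose N := block_mx (1%:M : 'M[R]_1) v u (x%:M : 'M[R]_k).
have NE : N = block_mx 1%:M 0 u 1%:M *m block_mx 1%:M v 0 (x%:M - u *m v).
  rewrite mulmx_block !mul1mx !mul0mx !mulmx1 !addr0.
  by rewrite addrC subrK.
have NQ : N *m block_mx x%:M 0 (- u) 1%:M =
    block_mx (x%:M - v *m u) v 0 (x%:M : 'M[R]_k).
  rewrite mulmx_block !mul1mx !mulmx0 !mulmx1 !add0r mulmxN.
  by rewrite mul_mx_scalar mulmxN mul_scalar_mx subrr.
have := congr1 determinant NQ.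
rewrite det_mulmx NE det_mulmx !det_lblock !det_ublock !det1 !det_scalar.
rewrite !mul1r mulr1 expr1 => e; rewrite mulrC e; congr (_ * _).
by rewrite [x%:M - _]mx11_scalar det_scalar1 !mxE eqxx mulr1n.
Qed.

Lemma char_poly_rank1 (F : fieldType) (k : nat) (u : 'cV[F]_k.+1)
    (v : 'rV[F]_k.+1) :
  char_poly (u *m v) =
  \prod_(y <- (v *m u) 0 0 :: nseq k 0) ('X - y%:P).
Proof.
have X0 : 'X != 0 :> {poly F} by rewrite -size_poly_eq0 size_polyX.
apply: (mulfI X0).
rewrite /char_poly /char_poly_mx map_mxM det_scalar_sub_rank1.
rewrite big_cons big_nseq subr0 iter_mulr_1 -map_mxM mxE exprS; ring.
Qed.

Section singular_values.
Variable R : realType.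

(** When the characteristic polynomial splits, its distinct roots repeated with
    their multiplicities are a permutation of any list of its linear
    factors. *)
Lemma singular_values_split (n m : nat) (A : 'M[R]_(n, m)) (s : seq R) :
  char_poly (A^T *m A) = \prod_(y <- s) ('X - y%:P) ->
  singular_values A = sort >=%R (map Num.sqrt s).
Proof.
move=> pE; apply/perm_sortP => //.
- exact: ge_total.
- exact: ge_trans.
- exact: ge_anti.
rewrite pE; set p := \prod_(y <- s) _.
have p0 : p != 0 by rewrite monic_neq0// monic_prod_XsubC.
have rootsE : perm_eq (rootsR p) (undup s).
  apply: uniq_perm; rewrite ?undup_uniq//; first by rewrite uniq_roots.
  by move=> y; rewrite -roots_on_rootsR// mem_undup in_itv/= root_prod_XsubC.
rewrite (eq_map (g := fun x => nseq (count_mem x s) (Num.sqrt x))); last first.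
  by move=> x; rewrite /p mu_prod_XsubC.
have /permPl -> := perm_flatten (perm_map
  (fun x => nseq (count_mem x s) (Num.sqrt x)) rootsE).
rewrite (eq_map (g := fun x => map Num.sqrt (nseq (count_mem x s) x))); last first.
  by move=> x; rewrite map_nseq.
by rewrite map_comp -map_flatten; apply: perm_map; exact: perm_count_undup.
Qed.

(** A = a b has A^T A = b^T (|a|^2 b), a product of a column and a row, so its
    only possibly nonzero eigenvalue is |a|^2 |b|^2. *)
Lemma singular_values_rank1 (n m : nat) (a : 'cV[R]_n) (b : 'rV[R]_m.+1) :
  singular_values (a *m b) =
    Num.sqrt ((\sum_i a i 0 ^+ 2) * (\sum_j b 0 j ^+ 2)) :: nseq m 0.
Proof.
rewrite (@singular_values_split _ _ _
  ((\sum_i a i 0 ^+ 2) * (\sum_j b 0 j ^+ 2) :: nseq m 0)); last first.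
  rewrite trmx_mul -mulmxA (mulmxA a^T) char_poly_rank1.
  congr (\prod_(y <- _ :: _) _).
  rewrite [a^T *m a]mx11_scalar mul_scalar_mx -scalemxAl mxE; congr (_ * _).
    by rewrite mxE; apply: eq_bigr => i _; rewrite mxE expr2.
  by rewrite mxE; apply: eq_bigr => i _; rewrite mxE expr2.
rewrite /= map_nseq sqrtr0; apply: sorted_sort; first exact: ge_trans.
rewrite /= path_min_sorted; last first.
  by apply/allP => x /nseqP[-> _]; exact: sqrtr_ge0.
elim: m {b} => [//|[|k] IH] //=.
by rewrite lexx; exact: IH.
Qed.

End singular_values.

(** * The pair of mean matrices *)

Section spiked.
Context (R : realType).
Implicit Types (kappa tau rho x y z w : R).

Lemma rank1_Mtau kappa tau (n m : nat) (a : 'cV[R]_n.+1) (b : 'rV[R]_m.+1) :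
  0 <= tau -> 0 <= kappa -> (forall i j, `|a i 0 * b 0 j| <= kappa) ->
  tau ^+ 2 <= (\sum_i a i 0 ^+ 2) * (\sum_j b 0 j ^+ 2) ->
  Mtau kappa tau (a *m b).
Proof.
move=> tau0 kappa0 ab_kappa tau_le; split; last first.
  rewrite /sigma singular_values_rank1 /=; split.
    by rewrite -(ger0_norm tau0) -sqrtr_sqr ler_wsqrtr.
  by rewrite nth_nseq; case: ifP.
split; last first.
  by apply: (leq_trans (mxrankM_maxl _ _)); apply: (leq_trans (rank_leq_col _)).
rewrite /Num.norm/=.
have [->//|/mx_norm_neq0[[i j] ->]/=] := eqVneq (mx_norm (a *m b)) 0.
by rewrite mxE big_ord1; exact: ab_kappa.
Qed.

Definition spiked (n m : nat) x y z w : 'M[R]_(n, m) :=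
  (\col_i if i == 0 :> nat then x else y) *m
  (\row_j if j == 0 :> nat then z else w).

Lemma spikedE n m x y z w i j : spiked n m x y z w i j =
  (if i == 0 :> nat then x else y) * (if j == 0 :> nat then z else w).
Proof. by rewrite mxE big_ord1 !mxE. Qed.

(** The factors may have different bounds p and q because the large entry
    kappa sits in the row or in the column, according to the shape. *)
Lemma spiked_Mtau (p q tau : R) n m x y z w : 0 <= tau ->
  0 <= x <= p -> 0 <= y <= p -> 0 <= z <= q -> 0 <= w <= q ->
  tau ^+ 2 <= (n.+1%:R * y ^+ 2) * (m.+1%:R * w ^+ 2) ->
  Mtau (p * q) tau (spiked n.+2 m.+2 x y z w).
Proof.
move=> tau0 /andP[x0 xp] /andP[y0 yp] /andP[z0 zq] /andP[w0 wq] tau_le.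
have p0 : 0 <= p by exact: le_trans xp.
have q0 : 0 <= q by exact: le_trans zq.
apply: rank1_Mtau => //; first exact: mulr_ge0.
  move=> i j; rewrite !mxE normrM.
  by apply: ler_pM => //; case: ifP; rewrite ger0_norm.
apply: (le_trans tau_le); apply: ler_pM; rewrite ?mulr_ge0 ?sqr_ge0//.
  rewrite big_ord_recl mxE /= -[leLHS]add0r lerD ?sqr_ge0//.
  under eq_bigr do rewrite mxE /=.
  by rewrite sumr_const card_ord mulr_natl.
rewrite big_ord_recl mxE /= -[leLHS]add0r lerD ?sqr_ge0//.
under eq_bigr do rewrite mxE /=.
by rewrite sumr_const card_ord mulr_natl.
Qed.

Lemma row_spike_dist n m x x' y z w :
  \sum_ij drop11 (spiked n.+1 m.+1 x y z w - spiked _ _ x' y z w) ij.1 ij.2 ^+ 2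
  = m%:R * ((x - x') * w) ^+ 2.
Proof.
rewrite -(pair_bigA _ (fun i j => drop11 (spiked n.+1 m.+1 x y z w -
  spiked _ _ x' y z w) i j ^+ 2)) /=.
rewrite big_ord_recl [X in _ + X]big1 ?addr0; last first.
  move=> i _; rewrite big1// => j _; by rewrite !mxE !big_ord1 !mxE/= subrr expr0n.
rewrite big_ord_recl mxE eqxx expr0n add0r.
under eq_bigr do rewrite !mxE !big_ord1 !mxE/= -mulrBl.
by rewrite sumr_const card_ord mulr_natl.
Qed.

Lemma col_spike_dist n m x y z z' w :
  \sum_ij drop11 (spiked n.+1 m.+1 x y z w - spiked _ _ x y z' w) ij.1 ij.2 ^+ 2
  = n%:R * (y * (z - z')) ^+ 2.
Proof.
rewrite -(pair_bigA _ (fun i j => drop11 (spiked n.+1 m.+1 x y z w -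
  spiked _ _ x y z' w) i j ^+ 2)) /= exchange_big /=.
rewrite big_ord_recl [X in _ + X]big1 ?addr0; last first.
  move=> i _; rewrite big1// => j _; by rewrite !mxE !big_ord1 !mxE/= andbF subrr expr0n.
rewrite big_ord_recl mxE eqxx expr0n add0r.
under eq_bigr do rewrite !mxE !big_ord1 !mxE/= -mulrBr.
by rewrite sumr_const card_ord mulr_natl.
Qed.

(** The spike eps goes into the shorter line through the corner, which then has
    at most min(n, T) - 1 perturbed entries, each of size eps * beta. *)
Lemma two_points_exist kappa tau rho (n0 T0 : nat) :
  let n := n0.+2 in let T := T0.+2 in
  0 < kappa -> 0 < tau -> tau <= kappa * Num.sqrt (n * T)%:R / 12 ->
  0 <= rho <= kappa ->
  exists M0 M1 : 'M[R]_(n, T),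
  [/\ Mnull kappa tau M0, Mrho kappa rho tau M1 &
   \sum_ij drop11 (M1 - M0) ij.1 ij.2 ^+ 2
     <= 8 * (rho * tau / kappa) ^+ 2 / (n + T)%:R].
Proof.
move=> n T kappa0 tau0 tau_le /andP[rho0 rhok].
pose eps := rho / kappa; pose s := Num.sqrt (n * T)%:R : R.
(* The factor 2 pays for the first row and column, which do not count in the
   lower bound on the singular value: n T <= 4 (n - 1) (T - 1). *)
pose beta := 2 * tau / s.
have predE k : k.+1%:R = k.+2%:R - 1 :> R by rewrite -[k.+2]addn1 natrD addrK.
have s2 : s ^+ 2 = n%:R * T%:R by rewrite sqr_sqrtr ?ler0n// natrM.
have s0 : 0 < s by rewrite sqrtr_gt0 ltr0n.
have n2 : 2 <= n%:R :> R by rewrite ler_nat.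
have T2 : 2 <= T%:R :> R by rewrite ler_nat.
have eps01 : 0 <= eps <= 1.
  by rewrite divr_ge0 ?(ltW kappa0)//= ler_pdivrMr// mul1r.
have beta0 : 0 <= beta by rewrite divr_ge0 ?ltW ?mulr_gt0.
have beta2 : beta ^+ 2 = 4 * tau ^+ 2 / (n%:R * T%:R).
  by rewrite /beta expr_div_n s2; congr (_ / _); ring.
have betak : 0 <= beta <= kappa.
  rewrite beta0/= ler_pdivrMr//; apply: le_trans (_ : 2 * (kappa * s / 12) <= _).
    by rewrite ler_pM2l.
  have : 0 < kappa * s by rewrite mulr_gt0.
  lra.
have kk : 0 <= kappa <= kappa by rewrite ltW//=.
have signal : tau ^+ 2 <= (n0.+1%:R * 1 ^+ 2) * (T0.+1%:R * beta ^+ 2).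
  rewrite beta2 expr1n mulr1 mulrA !mulrA ler_pdivlMr ?mulr_gt0//.
  rewrite (predE n0) (predE T0) -/n -/T.
  have t2 : 0 <= tau ^+ 2 by exact: sqr_ge0.
  have H : n%:R * T%:R <= (n%:R - 1) * (T%:R - 1) * 4 :> R by nra.
  have := ler_wpM2l t2 H; lra.
have signal' : tau ^+ 2 <= (n0.+1%:R * beta ^+ 2) * (T0.+1%:R * 1 ^+ 2).
  by apply: (le_trans signal); rewrite le_eqVlt; apply/orP; left; apply/eqP; ring.
have corner : `|eps * kappa| = rho by rewrite divfK ?gt_eqF// ger0_norm.
have r2 : (rho * tau / kappa) ^+ 2 = eps ^+ 2 * tau ^+ 2.
  by rewrite -exprMn /eps; congr (_ ^+ 2); ring.
have e2 : 0 <= eps ^+ 2 * tau ^+ 2 by rewrite mulr_ge0 ?sqr_ge0.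
have oneone : 0 <= (1 : R) <= 1 by rewrite ler01 lexx.
have zeroone : 0 <= (0 : R) <= 1 by rewrite ler01 lexx.
have tau_ge0 := ltW tau0.
(* Here b is the smaller dimension, so 1 / a <= 2 / (a + b). *)
have bound (a b : R) : 2 <= a -> 2 <= b -> b <= a ->
    (b - 1) * (eps ^+ 2 * (4 * tau ^+ 2 / (a * b)))
    <= 8 * (eps ^+ 2 * tau ^+ 2) / (a + b).
  move=> a2 b2 ba.
  have a0 : 0 < a by lra.
  have b0 : 0 < b by lra.
  have -> : (b - 1) * (eps ^+ 2 * (4 * tau ^+ 2 / (a * b))) =
    (b - 1) / (a * b) * 4 * (eps ^+ 2 * tau ^+ 2) by ring.
  have -> : 8 * (eps ^+ 2 * tau ^+ 2) / (a + b) =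
    (8 / (a + b)) * (eps ^+ 2 * tau ^+ 2) by ring.
  apply: ler_wpM2r => //; rewrite ler_pdivlMr; last lra.
  have -> : (b - 1) / (a * b) * 4 * (a + b) = ((b - 1) * 4 * (a + b)) / (a * b).
    by ring.
  rewrite ler_pdivrMr ?mulr_gt0//.
  nra.
have [nT|Tn] := leqP T n.
  exists (spiked n T 0 1 kappa beta), (spiked n T eps 1 kappa beta); split.
  - split; last by rewrite spikedE/= mul0r.
    by rewrite -[kappa in Mtau kappa]mul1r; apply: spiked_Mtau.
  - split; last by rewrite spikedE/= corner.
    by rewrite -[kappa in Mtau kappa]mul1r; apply: spiked_Mtau.
  rewrite row_spike_dist subr0 exprMn beta2 r2 natrD predE.
  by apply: bound => //; rewrite ler_nat.
exists (spiked n T kappa beta 0 1), (spiked n T kappa beta eps 1); split.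
- split; last by rewrite spikedE/= mulr0.
  rewrite -[kappa in Mtau kappa]mulr1; exact: spiked_Mtau.
- split; last by rewrite spikedE/= mulrC corner.
  rewrite -[kappa in Mtau kappa]mulr1; exact: spiked_Mtau.
rewrite col_spike_dist subr0 exprMn beta2 r2 natrD predE mulrC.
rewrite [n%:R * _]mulrC [n%:R + _]addrC mulrC [X in _ * X]mulrC.
by apply: bound => //; rewrite ler_nat ltnW.
Qed.
End spiked.

(** * The lower bound *)

Theorem theorem1 (R : realType) (alpha kappa : R)
    (alpha_gt0 : 0 < alpha) (alpha_lt1 : alpha < 1) (kappa_gt0 : 0 < kappa) :
  exists2 C : R, 0 < C &
    forall n0 T0 : nat, let n := n0.+2 in let T := T0.+2 in
    forall tau : R, 0 < tau -> tau <= kappa * Num.sqrt (n * T)%:R / 12 ->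
    forall (d : measure_display) (Omega : measurableType d)
      (P : probability Omega R) (u : 'I_n -> 'I_T -> {RV P >-> R}),
    iid_std_normal (fun it : 'I_n * 'I_T => u it.1 it.2) ->
    forall psi : 'M[R]_(n, T) -> R,
    mx_measurable_fun psi -> (forall A, 0 <= psi A <= 1) ->
    (ereal_sup [set Epsi u psi M | M in Mnull kappa tau] <= alpha%:E)%E ->
    let rho := C * Num.min 1 (Num.sqrt (n + T)%:R / tau) in
    (ereal_inf [set Epsi u psi M | M in Mrho kappa rho tau]
       <= (2 * alpha)%:E)%E.
Proof.
pose D := ln (1 + alpha ^+ 2).
have D0 : 0 < D by rewrite ln_gt0// ltrDl exprn_gt0.
have sD0 : 0 < Num.sqrt (D / 8) by rewrite sqrtr_gt0 divr_gt0.
(* C = kappa * c, where c <= 1 keeps rho below kappa and 8 c^2 <= D bounds the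
   distance of the two points. *)
pose c := Num.min 1 (Num.sqrt (D / 8)).
have c0 : 0 < c by rewrite lt_min ltr01.
have c1 : c <= 1 by rewrite ge_min lexx.
have c2 : 8 * c ^+ 2 <= D.
  have : c ^+ 2 <= D / 8.
    have D8 : 0 <= D / 8 by rewrite ltW// divr_gt0.
    rewrite -[leRHS](sqr_sqrtr D8) lerXn2r ?nnegrE ?(ltW c0) ?(ltW sD0)//.
    by rewrite ge_min lexx orbT.
  lra.
exists (kappa * c); first by rewrite mulr_gt0.
move=> n0 T0 n T tau tau0 tau_le d Omega P u iidu psi mpsi psi01 level /=.
set t := Num.min 1 _; set rho := kappa * c * t.
have s0 : 0 < Num.sqrt (n + T)%:R :> R by rewrite sqrtr_gt0 ltr0n.
have t0 : 0 < t by rewrite lt_min ltr01 divr_gt0.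
have t1 : t <= 1 by rewrite ge_min lexx.
have t2 : t * tau <= Num.sqrt (n + T)%:R.
  by rewrite -ler_pdivlMr// ge_min lexx orbT.
have rho01 : 0 <= rho <= kappa.
  rewrite /rho !mulr_ge0 ?(ltW kappa_gt0) ?(ltW c0) ?(ltW t0)//=.
  by rewrite -mulrA ler_piMr ?(ltW kappa_gt0)// mulr_ile1 ?(ltW c0) ?(ltW t0).
have [M0 [M1 [M0null M1rho dist]]] :=
  two_points_exist (n0 := n0) (T0 := T0) kappa_gt0 tau0 tau_le rho01.
have distD : \sum_ij drop11 (M1 - M0) ij.1 ij.2 ^+ 2 <= D.
  apply: (le_trans dist); rewrite ler_pdivrMr ?ltr0n//.
  have -> : rho * tau / kappa = c * (t * tau).
    by rewrite /rho; field; rewrite gt_eqF.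
  rewrite exprMn mulrA; apply: ler_pM => //; first by rewrite mulr_ge0 ?sqr_ge0.
    exact: sqr_ge0.
  rewrite -[leRHS](sqr_sqrtr (ler0n _ _)).
  by rewrite lerXn2r// nnegrE ?(ltW s0)// mulr_ge0 ?(ltW t0) ?(ltW tau0).
apply: (@le_trans _ _ (Epsi u psi M1)).
  by apply: ereal_inf_lbound; exists M1.
apply: (le_trans (Epsi_two_point iidu mpsi psi01 alpha_gt0 distD)).
have : (Epsi u psi M0 <= alpha%:E)%E.
  by apply: le_trans level; apply: ereal_sup_ubound; exists M0.
move=> le0; apply: (le_trans (leeD2r _ le0)).
by rewrite -EFinD lee_fin mulr2n mulrDl mul1r.
Qed.
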